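(* Consider a data tensor network $G_D$ with each vertex adjacent to an edge to be sketched, and a given contraction tree $T_0$ of $G_D$. If each contraction in $T_0$ contracts dimensions with size being at least the sketch size $m=\Theta(N\log(1/\delta)/\epsilon^2)$ (that is, $b_i\ge m$ for every contraction $(U_i,V_i)\in T_0$), then sketching with the tree embedding yields the optimal asymptotic cost, i.e. its cost is $O(c_{\mathrm{opt}})$, where $c_{\mathrm{opt}}$ is the minimum of $C(T_B)$ over all embeddings $G_E\in\mathcal G^{(\epsilon,\delta)}$ and all contraction trees $T_B$ of $(G_D,G_E)$ constrained on $T_0$.
   Context: **Tensor networks.** A tensor network is an undirected hypergraph $G=(V,E,w)$: each vertex is a tensor, each hyperedge a tensor dimension, $w(e)\ge0$ the natural log of the dimension size. A hyperedge is uncontracted if it has a dangling end (not adjacent to a vertex), and contracted otherwise (adjacent to at least two vertices). **Data and embedding.** The data $G_D=(V_D,E_D,w)$ is a hypergraph tensor network with a set $\bar E=\{e_1,\dots,e_N\}\subseteq E_D$ of uncontracted edges to be sketched; $e_j$ is adjacent to exactly one vertex $v_j\in V_D$, the $v_j$ are distinct, and $s_j=\exp(w(e_j))$. An embedding is a graph tensor network $G_E=(V_E,E_E,w)$, $N_E=|V_E|$, with $\bar E\subseteq E_E$: in the combined network $e_j$ joins $v_j$ to an embedding vertex; the other edges of $E_E$ join two embedding vertices or are uncontracted output edges $E_1\subset E_E$ adjacent to one embedding vertex. The sketch size is $m=\exp(\sum_{e\in E_1}w(e))$. Standing assumption: each $s_j>m$. The combined network is $G=(V,E,w)$, $V=V_E\cup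 V_D$, $E=E_E\cup E_D$; also $L=(V,E_E,w)$, $R=(V,E\setminus E_E,w)$. **Cuts and cost.** For a (hyper)graph $H$ on $V$ and disjoint $A,B\subseteq V$: $\mathrm{cut}_H(A,B)$ is the total weight of hyperedges adjacent to both $A$ and $B$; $\mathrm{cut}_H(A,* )$ the total weight of uncontracted hyperedges adjacent only to vertices of $A$; $\mathrm{cut}_H(A)=\mathrm{cut}_H(A,V\setminus A)+\mathrm{cut}_H(A,* )$. $\mathrm{cost}_H(A,B)=\mathrm{cut}_H(A)+\mathrm{cut}_H(B)-\mathrm{cut}_H(A,B)$. **Contraction trees.** A contraction tree of a network on $V$ is a rooted binary tree whose vertices are subsets of $V$, leaves are singletons, the root is $V$, and each internal vertex $W$ is the disjoint union of its children $W_1,W_2$ (the contraction $(W_1,W_2)$). Contracting $(W_1,W_2)$ costs $\exp(\mathrm{cost}_G(W_1,W_2))$ (classical dense matrix multiplication), and $C(T_B)$ is the sum over all contractions. $T_B$ for $(G_D,G_E)$ is constrained on $T_0$ (a contraction tree of $G_D$) if for each $(A,B)\in T_0$ there is $(\hat A,\hat B)\in T_B$ with $\hat A\cap V_D=A$, $\hat B\cap V_D=B$. $O,\Omega,\Theta$ hide absolute constants. **Class $\mathcal G^{(\epsilon,\delta)}$.** A sketching linearization $G_S$ is obtained by choosing an ordering of $V$ in which data vertices precede embedding vertices, and directing every contracted edge of $L$ to its higher-indexed endpoint and every uncontracted edge outward; $\mathrm{cut}_{G_S}(v)$ is the total weight of edges leaving $v$ (including outward dangling ones). $\mathcal G^{(\epsilon,\delta)}$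 is the set of Gaussian embeddings (independent tensors with i.i.d. normalized Gaussian entries) with $|E_1|=1$, $m=\Theta(N_E\log(1/\delta)/\epsilon^2)$, for which some sketching linearization has effective sketch dimension of size $\Omega(N_E\log(1/\delta)/\epsilon^2)$ at each embedding vertex, taken as $\mathrm{cut}_{G_S}(v)\ge\log m$ for all $v\in V_E$. **Notation for $T_0$.** Write a topological order of $T_0$ as $(U_1,V_1),\dots,(U_{N-1},V_{N-1})$ (here $|V_D|=N$), and let $a_i=\exp(\mathrm{cut}_R(U_i)-\mathrm{cut}_R(U_i,V_i))$, $c_i=\exp(\mathrm{cut}_R(V_i)-\mathrm{cut}_R(U_i,V_i))$, $d_i=\exp(\mathrm{cut}_R(U_i\cup V_i))/(a_ic_i)$, $b_i=\exp(\mathrm{cut}_R(U_i,V_i))/d_i$ ($b_i$ is the size of the dimensions contracted between $U_i$ and $V_i$). **Sketching with the tree embedding**, with $m=\Theta(N\log(1/\delta)/\epsilon^2)$: (1) each $v_j$ is contracted with a Gaussian $s_j\times m$ matrix along $e_j$; (2) going through $(U_i,V_i)$ in order, with $\hat U_i,\hat V_i$ the already sketched versions of $U_i,V_i$ (each having one sketched dimension of size $m$), a single Gaussian tensor $z_i$ of size $m\times m\times m$, connected to the sketched dimensions of $\hat U_i$ and $\hat V_i$ and with one output dimension of size $m$, is applied via the contraction order $((\hat U_i,\hat V_i),z_i)$. Its cost is the total cost of all these contractions.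
   Formalization: The minimum c_opt is taken only over embeddings in the class whose own sketch size is also at least a constant times N log(1/δ)/ε²; without this, embeddings with very few tensors (N_E much smaller than N) have far smaller sketch size and beat the tree embedding by an unbounded factor. *)

(* Defs.v *)
From HB Require Import structures.
From mathcomp Require Import all_boot all_order all_algebra.
From mathcomp Require Import reals sequences exp.

Set Implicit Arguments.
Unset Strict Implicit.
Unset Printing Implicit Defensive.

Import Order.TTheory GRing.Theory Num.Theory.
Local Open Scope ring_scope.

(** * Tensor networks and cuts *)

(* Edges are indexed by a type, so that parallel edges (for instance several
   dangling edges at one vertex) are allowed. [inc e] is the set of vertices
   adjacent to [e]; [dangling e] says that [e] is uncontracted. *)
Record network (V E : finType) := Network {
  inc : E -> {set V};
  dangling : E -> bool;
  dim_size : E -> nat }.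

Definition is_network (V E : finType) (G : network V E) : Prop :=
  forall e, [/\ (0 < dim_size G e)%N, inc G e != set0
              & ~~ dangling G e -> (2 <= #|inc G e|)%N].

Definition is_graph (V E : finType) (G : network V E) : Prop :=
  forall e, #|inc G e| = if dangling G e then 1%N else 2%N.

Definition weight (R : realType) (V E : finType) (G : network V E) (e : E) : R :=
  ln (dim_size G e)%:R.

Definition adj (V E : finType) (G : network V E) (e : E) (A : {set V}) : bool :=
  inc G e :&: A != set0.

(* In the following four definitions the hypergraph H has the vertices of [G]
   and only those edges of [G] that are in [F]. *)
Definition cut2 (R : realType) (V E : finType) (G : network V E) (F : {set E})
    (A B : {set V}) : R :=
  \sum_(e in F | adj G e A && adj G e B) weight R G e.

Definition cut_star (R : realType) (V E : finType) (G : network V E)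
    (F : {set E}) (A : {set V}) : R :=
  \sum_(e in F | [&& dangling G e, inc G e != set0 & inc G e \subset A])
    weight R G e.

Definition cut (R : realType) (V E : finType) (G : network V E) (F : {set E})
    (A : {set V}) : R :=
  cut2 R G F A (~: A) + cut_star R G F A.

Definition cost (R : realType) (V E : finType) (G : network V E) (F : {set E})
    (A B : {set V}) : R :=
  cut R G F A + cut R G F B - cut2 R G F A B.

(** * Contraction trees *)

Inductive ctree (V : Type) : Type :=
| CLeaf of V
| CNode of ctree V & ctree V.

Fixpoint vset (V : finType) (t : ctree V) : {set V} :=
  match t with
  | CLeaf v => [set v]
  | CNode l r => vset l :|: vset r
  end.

Fixpoint contractions (V : finType) (t : ctree V) : seq ({set V} * {set V}) :=
  match t with
  | CLeaf _ => [::]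
  | CNode l r => contractions l ++ contractions r ++ [:: (vset l, vset r)]
  end.

Definition is_contraction_tree (V : finType) (t : ctree V) : Prop :=
  vset t = [set: V] /\
  forall A B, (A, B) \in contractions t -> [disjoint A & B].

Definition tree_cost (R : realType) (V E : finType) (G : network V E)
    (t : ctree V) : R :=
  \sum_(p <- contractions t) expR (cost R G [set: E] p.1 p.2).

(** * Data, embeddings and the combined network *)

Definition is_data (VD ED : finType) (GD : network VD ED) (Ebar : {set ED}) :
    Prop :=
  [/\ is_network GD,
      forall e, e \in Ebar -> dangling GD e /\ #|inc GD e| = 1%N
    & {in Ebar &, injective (inc GD)}].

(* The edges of an embedding are the sketched edges (left summand) together with
   the edges that do not belong to the data (right summand, type [EX]). On its
   own, the embedding sees the sketched edges as dangling. *)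
Definition is_embedding (VD ED VE EX : finType) (GD : network VD ED)
    (Ebar : {set ED}) (GE : network VE ({e : ED | e \in Ebar} + EX)%type) :
    Prop :=
  [/\ is_network GE, is_graph GE
    & forall e, dangling GE (inl e) /\ dim_size GE (inl e) = dim_size GD (val e)].

Definition combine (VD ED VE EX : finType) (GD : network VD ED)
    (Ebar : {set ED}) (GE : network VE ({e : ED | e \in Ebar} + EX)%type) :
    network (VD + VE)%type (ED + EX)%type :=
  Network
    (fun e : ED + EX => match e with
     | inl e0 => [set inl v | v in inc GD e0] :|:
         [set inr z | z in if insub e0 is Some e1 then inc GE (inl e1) else set0]
     | inr e0 => [set inr z | z in inc GE (inr e0)]
     end)
    (fun e : ED + EX => match e with
     | inl e0 => dangling GD e0 && (e0 \notin Ebar)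
     | inr e0 => dangling GE (inr e0)
     end)
    (fun e : ED + EX => match e with
     | inl e0 => dim_size GD e0
     | inr e0 => dim_size GE (inr e0)
     end).

Definition output_edges (ES VE EX : finType) (GE : network VE (ES + EX)%type) :
    {set EX} := [set e | dangling GE (inr e)].

Definition sketch_size (R : realType) (ES VE EX : finType)
    (GE : network VE (ES + EX)%type) : R :=
  expR (\sum_(e in output_edges GE) weight R GE (inr e)).

Definition constrained (VD VE : finType) (T0 : ctree VD)
    (TB : ctree (VD + VE)%type) : Prop :=
  forall A B, (A, B) \in contractions T0 ->
  exists A' B' : {set VD + VE},
    [/\ (* the two children of a tree vertex are unordered *)
        ((A', B') \in contractions TB) || ((B', A') \in contractions TB),
        [set v | inl v \in A'] = A & [set v | inl v \in B'] = B].

(** * The class of Gaussian embeddings *)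

(* The edges of the embedding, inside the combined network: this is L. *)
Definition L_edges (ED : finType) (Ebar : {set ED}) (EX : finType) :
    {set ED + EX} :=
  [set e | if e is inl e0 then e0 \in Ebar else true].

(* Total weight of the edges of L leaving [v] when the vertices are numbered by
   [sigma], contracted edges point to their higher end and dangling edges point
   outward. *)
Definition cut_out (R : realType) (VD ED VE EX : finType) (GD : network VD ED)
    (Ebar : {set ED}) (GE : network VE ({e : ED | e \in Ebar} + EX)%type)
    (sigma : VD + VE -> 'I_#|{: VD + VE}|) (v : VD + VE) : R :=
  let G := combine GD GE in
  \sum_(e in L_edges Ebar EX | (v \in inc G e) &&
      (dangling G e || [exists u in inc G e, (sigma v < sigma u)%N]))
    weight R G e.

Definition is_linearization (VD VE : finType)
    (sigma : VD + VE -> 'I_#|{: VD + VE}|) : Prop :=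
  injective sigma /\ forall v z, (sigma (inl v) < sigma (inr z))%N.

(* [m = Theta(n log(1/delta) / eps^2)] with constants [k1] and [k2]. *)
Definition theta_size (R : realType) (k1 k2 eps delta : R) (n : nat) (m : R) :
    Prop :=
  let L := ln (1 / delta) / eps ^+ 2 in
  k1 * (n%:R * L) <= m /\ m <= k2 * (n%:R * L).

(* The joint law of the (independent, normalized Gaussian) tensors of an
   embedding is determined by its network, and neither membership in the class
   nor any cost refers to their entries; hence the class is a predicate on the
   network. [k1] and [k2] are the constants of the Theta. *)
Definition in_gaussian_class (R : realType) (k1 k2 eps delta : R)
    (VD ED VE EX : finType) (GD : network VD ED) (Ebar : {set ED})
    (GE : network VE ({e : ED | e \in Ebar} + EX)%type) : Prop :=
  [/\ is_embedding GD GE,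
      #|output_edges GE| = 1%N,
      theta_size k1 k2 eps delta #|VE| (sketch_size R GE)
    & exists2 sigma, is_linearization sigma
      & forall z, ln (sketch_size R GE) <= cut_out R GD GE sigma (inr z)].

(* The costs over which the optimum is taken. The sketch size of every competing
   embedding is of the order [N log(1/delta) / eps^2] at least, [N] being the
   number of sketched edges. An embedding of the class with the same sketch size
   as the tree embedding, or with at least [N] vertices, satisfies this. Without
   it, merging many sketched edges into very few Gaussian tensors would allow a
   sketch size smaller by an unbounded factor. *)
Definition constrained_costs (R : realType) (k1 k2 eps delta : R)
    (VD ED : finType) (GD : network VD ED) (Ebar : {set ED}) (T0 : ctree VD) :
    R -> Prop :=
  fun c => exists (VE EX : finType)
      (GE : network VE ({e : ED | e \in Ebar} + EX)%type)
      (TB : ctree (VD + VE)%type),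
    [/\ in_gaussian_class k1 k2 eps delta GD GE
          /\ k1 * (#|Ebar|%:R * (ln (1 / delta) / eps ^+ 2))
               <= sketch_size R GE,
        forall e, e \in Ebar -> sketch_size R GE < (dim_size GD e)%:R,
        is_contraction_tree TB,
        constrained T0 TB
      & c = tree_cost R (combine GD GE) TB].

Definition is_minimum (R : realType) (S : R -> Prop) (c : R) : Prop :=
  S c /\ forall x, S x -> c <= x.

(** * Dimension sizes of the contractions of the data *)

(* The edges of R are the data edges that are not sketched; they are adjacent to
   data vertices only, so the cuts of R can be taken in the data network. *)
Section DataSizes.
Context (R : realType) (VD ED : finType) (GD : network VD ED) (Ebar : {set ED}).
Implicit Types U W : {set VD}.

Definition cutR2 U W : R := cut2 R GD (~: Ebar) U W.
Definition cutR U : R := cut R GD (~: Ebar) U.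

Definition size_a U W : R := expR (cutR U - cutR2 U W).
Definition size_c U W : R := expR (cutR W - cutR2 U W).
Definition size_d U W : R := expR (cutR (U :|: W)) / (size_a U W * size_c U W).
Definition size_b U W : R := expR (cutR2 U W) / size_d U W.

End DataSizes.

(** * The tree embedding *)

(* The vertices of a tree; [None] is the root of an internal node. *)
Fixpoint tnode (V : Type) (t : ctree V) : finType :=
  match t with
  | CLeaf _ => unit
  | CNode l r => option (tnode l + tnode r)%type
  end.

(* In the second and third branches, [omap] sends the absence of a parent in the
   subtree to [None], the root of the whole tree. *)
Fixpoint tparent (V : Type) (t : ctree V) : tnode t -> option (tnode t) :=
  match t return tnode t -> option (tnode t) with
  | CLeaf _ => fun _ => None
  | CNode l r => fun x : option (tnode l + tnode r) =>
      match x with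
      | None => None
      | Some (inl y) => Some (omap inl (tparent y))
      | Some (inr y) => Some (omap inr (tparent y))
      end
  end.

Fixpoint tleaf (V : Type) (t : ctree V) : tnode t -> option V :=
  match t return tnode t -> option V with
  | CLeaf v => fun _ => Some v
  | CNode l r => fun x : option (tnode l + tnode r) =>
      match x with
      | None => None
      | Some (inl y) => tleaf y
      | Some (inr y) => tleaf y
      end
  end.

(* One embedding tensor per vertex x of T0: the s_j * m matrix applied to v_j if
   x is the leaf {v_j}, the m * m * m tensor z_i if x is the contraction
   (U_i, V_i). Each tensor has one output edge of size m, also indexed by x,
   which goes to the tensor of the parent of x and dangles at the root. *)
Definition tree_embedding (VD ED : finType) (GD : network VD ED)
    (Ebar : {set ED}) (T0 : ctree VD) (m : nat) :
    network (tnode T0) ({e : ED | e \in Ebar} + tnode T0)%type :=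
  Network
    (fun e : {e : ED | e \in Ebar} + tnode T0 => match e with
     | inl e0 => [set x | if tleaf x is Some v then v \in inc GD (val e0)
                          else false]
     | inr x => [set y | (y == x) || (Some y == tparent x)]
     end)
    (fun e : {e : ED | e \in Ebar} + tnode T0 => match e with
     | inl _ => true
     | inr x => tparent x == None
     end)
    (fun e : {e : ED | e \in Ebar} + tnode T0 => match e with
     | inl e0 => dim_size GD (val e0)
     | inr _ => m
     end).

(* [z x] is the embedding tensor attached to the vertex [x] of [t]. A leaf is
   first contracted with its matrix; then the sketched U_i and V_i are
   contracted together, and the result with z_i. *)
Fixpoint sketch_tree (VD VE : Type) (t : ctree VD) :
    (tnode t -> VE) -> ctree (VD + VE)%type :=
  match t return (tnode t -> VE) -> ctree (VD + VE)%type with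
  | CLeaf v => fun z => CNode (CLeaf (inl v)) (CLeaf (inr (z tt)))
  | CNode l r => fun z : option (tnode l + tnode r) -> VE =>
      CNode (CNode (sketch_tree (fun x => z (Some (inl x))))
                   (sketch_tree (fun x => z (Some (inr x)))))
            (CLeaf (inr (z None)))
  end.

Definition tree_embedding_cost (R : realType) (VD ED : finType)
    (GD : network VD ED) (Ebar : {set ED}) (T0 : ctree VD) (m : nat) : R :=
  tree_cost R (combine GD (tree_embedding GD Ebar T0 m))
    (sketch_tree (t := T0) id).

(* Main.v *)
Require Import Defs.
From mathcomp Require Import all_boot all_order all_algebra.
From mathcomp Require Import reals sequences exp.
From mathcomp Require Import boolp lra.
Import Defs.
Import Order.TTheory GRing.Theory Num.Theory.
Local Open Scope ring_scope.

Set Implicit Arguments.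
Unset Strict Implicit.
Unset Printing Implicit Defensive.

(** For disjoint [A] and [B] the cost of a contraction is the total weight of the
    edges that are free in [A] or in [B] ([costE]). In the combined network this
    splits into the edges of R, which depend only on the data parts of [A] and
    [B], and the edges of L ([cost_combine]). A contraction tree constrained on
    [T0] thus pays, for each contraction [(U, W)] of [T0], the factor [a b c d]
    given by R, times the factor given by L. Everything turns on comparing the
    factors from L.

    Lower bound. Take the last vertex of [A] and the last vertex of [B] in the
    sketching linearization. The edges of L that leave them go out of [A],
    respectively [B], and form disjoint families since a directed edge has one
    tail. Each family weighs at least the logarithm of the sketch size [m'] of
    the competing embedding: by the class condition at an embedding vertex,
    because of its large sketched edge at a data vertex. So the factor from L is
    at least [m' ^ 2] ([cost_ge_internal]). In the first contraction involving a
    data vertex [v], the sketched edge of [v] itself is one of the families, and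
    the factor is at least [s m'] ([cost_ge_leaf]). One contraction of the
    competitor is charged at most twice in each of these two ways.

    Upper bound. A subtree sketched by the tree embedding has a single sketched
    dimension. Sketching [v] costs the factor [s m]; at a contraction [(U, W)]
    the two steps cost [a b c d m ^ 2] and [a c d m ^ 3], and the hypothesis
    [m <= b] says that the first dominates ([sketch_tree_cost_le]). As [m] is at
    most [(k2 / k1) m'], the bounds match up to a constant that depends only on
    [k2 / k1].

    The minimum is attained because all costs are natural numbers
    ([tree_cost_nat]) and the star-shaped embedding [star_embedding] shows that
    there is an admissible one. *)

(** * Costs as sums over boundary edges *)

Section Cuts.
Context (R : realType) (V E : finType) (G : network V E).
Implicit Types (A B : {set V}) (F : {set E}) (e : E).

(** The free indices of the tensor obtained by contracting the vertices in
    [A]: these are the edges whose weights make up [cut A]. *)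
Definition sticks_out e A := adj G e A && (adj G e (~: A) || dangling G e).

Lemma weight_ge0 e : 0 <= weight R G e.
Proof.
rewrite /weight; case: (dim_size G e) => [|n]; first by rewrite ln0.
by rewrite ln_ge0// ler1n.
Qed.

Lemma adjP e A : reflect (exists2 x, x \in inc G e & x \in A) (adj G e A).
Proof.
rewrite /adj; apply: (iffP (set0Pn _)) => [[x /setIP[]]|[x xe xA]]; first by exists x.
by exists x; apply/setIP.
Qed.

Lemma adjC e A : adj G e (~: A) = ~~ (inc G e \subset A).
Proof. by rewrite /adj -setDE setD_eq0. Qed.

Lemma adjU e A B : adj G e (A :|: B) = adj G e A || adj G e B.
Proof. by rewrite /adj setIUr setU_eq0 negb_and. Qed.

Lemma sticks_out0 e : sticks_out e set0 = false.
Proof. by rewrite /sticks_out /adj setI0 eqxx. Qed.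

(** An edge closed up inside [A] cannot become free in a larger set. *)
Lemma sticks_outU e A B : sticks_out e (A :|: B) ->
  sticks_out e A || sticks_out e B.
Proof.
rewrite /sticks_out adjU; case/andP => AB out.
have mono (C D : {set V}) : C \subset D -> adj G e C -> adj G e D.
  by move=> CD /adjP[x xe xC]; apply/adjP; exists x => //; exact: (subsetP CD).
have outl (C : {set V}) : C \subset A :|: B -> adj G e (~: C) || dangling G e.
  by move=> CAB; case/orP: out => [/mono->|->]; rewrite ?orbT// setCS.
by rewrite !outl ?subsetUl ?subsetUr// !andbT.
Qed.

Lemma cutE F A : cut R G F A = \sum_(e in F | sticks_out e A) weight R G e.
Proof.
rewrite /cut /cut2 /cut_star [RHS](bigID (fun e => adj G e (~: A))) /=.
congr (_ + _); apply: eq_bigl => e; rewrite /sticks_out adjC.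
  by case: (e \in F); case: (adj G e A); case: (inc G e \subset A); rewrite ?andbF.
case: (boolP (inc G e \subset A)) => [eA|_]; last by rewrite !andbF.
rewrite /adj (setIidPl eA).
by case: (e \in F); case: (dangling G e); case: (inc G e == set0).
Qed.

(** When [A] and [B] are disjoint, an edge that meets both is free in each of
    them, so the subtracted [cut2] removes precisely the double count in
    [cut A + cut B]. *)
Lemma adj_sticks_out e A B : [disjoint A & B] ->
  adj G e A && adj G e B = sticks_out e A && sticks_out e B.
Proof.
move=> dAB; rewrite /sticks_out.
case eA : (adj G e A); case eB : (adj G e B) => //=; last by rewrite andbF.
have [x xe xA] := adjP _ _ eA; have [y ye yB] := adjP _ _ eB.
have -> : adj G e (~: A).
  by apply/adjP; exists y => //; rewrite inE (disjointFl dAB).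
have -> // : adj G e (~: B).
by apply/adjP; exists x => //; rewrite inE (disjointFr dAB).
Qed.

(** The working form of the cost. All coefficients are 0 or 1: upper bounds on
    costs list the possible edges, lower bounds exhibit some of them, and
    [expR (cost A B)] is a product of dimension sizes. *)
Lemma costE F A B : [disjoint A & B] -> cost R G F A B =
  \sum_(e in F | sticks_out e A || sticks_out e B) weight R G e.
Proof.
move=> dAB; rewrite /cost !cutE /cut2 !big_mkcondr -big_split -sumrB /=.
apply: eq_bigr => e _; rewrite adj_sticks_out//.
by case: (sticks_out e A); case: (sticks_out e B);
  rewrite /= ?addr0 ?add0r ?subr0 ?addrK ?oppr0.
Qed.

(** The contraction of [U] with an embedding tensor restricts to the data as the
    pair [(U, set0)]. *)
Lemma cost_set0 F A : cost R G F A set0 = cut R G F A.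
Proof.
rewrite costE ?cutE; last by rewrite -setI_eq0 setI0.
by apply: eq_bigl => e; rewrite sticks_out0 orbF.
Qed.

Lemma costC F A B : cost R G F A B = cost R G F B A.
Proof.
rewrite /cost [cut _ _ _ A + _]addrC; congr (_ - _).
by apply: eq_bigl => e; rewrite [adj G e A && _]andbC.
Qed.

Lemma le_cut_cost F A B : [disjoint A & B] -> cut R G F A <= cost R G F A B.
Proof.
move=> dAB; rewrite costE// cutE big_mkcondr [leRHS]big_mkcondr.
apply: ler_sum => e _; case: (sticks_out e A) => //=.
by case: ifP => // _; exact: weight_ge0.
Qed.

Lemma expR_sum_weight (P : pred E) : (forall e, 0 < dim_size G e)%N ->
  expR (\sum_(e | P e) weight R G e) = (\prod_(e | P e) dim_size G e)%:R.
Proof.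
move=> G0; rewrite expR_sum natr_prod; apply: eq_bigr => e _.
by rewrite lnK// posrE ltr0n.
Qed.

Lemma sum_weight_sub (P : pred E) (s : seq E) : (forall e, P e -> e \in s) ->
  \sum_(e | P e) weight R G e <= \sum_(e <- s) weight R G e.
Proof.
move=> Ps; rewrite [leLHS]big_mkcond.
apply: (@le_trans _ _ (\sum_(e <- undup s) weight R G e)); last first.
  elim: s {Ps} => //= a s IH; case: ifP => _; rewrite !big_cons ?lerD2l//.
  by rewrite -[leLHS]add0r lerD ?weight_ge0.
rewrite (big_uniq _ (undup_uniq s)) [leRHS]big_mkcond.
apply: ler_sum => e _; rewrite mem_undup; case: ifP => [/Ps ->//|_].
by case: ifP => // _; exact: weight_ge0.
Qed.

End Cuts.

(** * Contraction trees and charging *)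

Section Trees.
Context (V : finType).
Implicit Types (t : ctree V) (A B : {set V}).

Definition disjoint_children t :=
  forall A B, (A, B) \in contractions t -> [disjoint A & B].

Lemma mem_contractions_node l r A B :
  ((A, B) \in contractions (CNode l r)) =
  [|| (A, B) \in contractions l, (A, B) \in contractions r |
      (A, B) == (vset l, vset r)].
Proof. by rewrite /= !mem_cat inE. Qed.

Lemma disjoint_childrenP l r : disjoint_children (CNode l r) ->
  [/\ disjoint_children l, disjoint_children r & [disjoint vset l & vset r]].
Proof.
move=> dt; split=> [A B AB|A B AB|]; apply: dt;
  by rewrite mem_contractions_node ?AB ?eqxx ?orbT.
Qed.

Lemma vset_neq0 t : vset t != set0.
Proof.
elim: t => [v|l IHl r _] /=; first by apply/set0Pn; exists v; rewrite inE.
by rewrite setU_eq0 negb_and IHl.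
Qed.

Lemma contractions_neq0 t A B : (A, B) \in contractions t ->
  A != set0 /\ B != set0.
Proof.
elim: t => [//|l IHl r IHr]; rewrite mem_contractions_node.
by case/or3P => [/IHl|/IHr|/eqP[-> ->]] //; rewrite !vset_neq0.
Qed.

Lemma contractions_sub t A B : (A, B) \in contractions t ->
  (A \subset vset t) && (B \subset vset t).
Proof.
elim: t => [//|l IHl r IHr]; rewrite mem_contractions_node /=.
case/or3P => [/IHl/andP[Al Bl]|/IHr/andP[Ar Br]|/eqP[-> ->]].
- by rewrite !(subset_trans _ (subsetUl _ _)).
- by rewrite !(subset_trans _ (subsetUr _ _)).
- by rewrite subsetUl subsetUr.
Qed.

(** Were the same pair contracted twice, once in each of two disjoint subtrees or
    in a subtree and at its parent, a nonempty set of vertices would lie on both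
    sides of a node. *)
Lemma contractions_uniq t : disjoint_children t -> uniq (contractions t).
Proof.
elim: t => [//|l IHl r IHr] /disjoint_childrenP[/IHl ul /IHr ur dlr] /=.
have nlr A : A != set0 -> A \subset vset l -> A \subset vset r -> False.
  move=> A0 Al Ar; move: dlr; rewrite -setI_eq0 -subset0 => /subsetP lr0.
  case/set0Pn: A0 => x xA; have := lr0 x.
  by rewrite !inE (subsetP Al _ xA) (subsetP Ar _ xA) => /(_ isT).
rewrite !cat_uniq ul ur has_cat /= !orbF !andbT negb_or -!andbA.
apply/and3P; split.
- apply/hasPn => -[A B] ABr; apply/negP => ABl.
  have [A0 _] := contractions_neq0 ABl.
  have /andP[Al _] := contractions_sub ABl.
  have /andP[Ar _] := contractions_sub ABr.
  exact: nlr Ar.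
- apply/negP => /contractions_sub/andP[_ rl].
  by apply: (nlr (vset r)) => //; exact: vset_neq0.
- apply/negP => /contractions_sub/andP[lr _].
  by apply: (nlr (vset l)) => //; exact: vset_neq0.
Qed.

(** The first contraction in which the single vertex [x] takes part. *)
Lemma leaf_contraction t x : x \in vset t -> vset t != [set x] ->
  exists2 q, q \in contractions t & (q.1 == [set x]) || (q.2 == [set x]).
Proof.
elim: t => [v|l IHl r IHr] /=; first by rewrite inE => /eqP->; rewrite eqxx.
move=> xlr _.
have lrt q : q \in contractions l ++ contractions r ->
    q \in contractions (CNode l r).
  by rewrite mem_cat /= catA mem_cat mem_cat => ->.
case: (boolP ((vset l == [set x]) || (vset r == [set x]))) => [lrx|].
  by exists (vset l, vset r); rewrite // !mem_cat !inE eqxx !orbT.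
rewrite negb_or => /andP[lx rx].
case/setUP: xlr => [/IHl/(_ lx)|/IHr/(_ rx)] [q qt qx]; exists q => //;
  by apply: lrt; rewrite mem_cat qt ?orbT.
Qed.

End Trees.

Lemma sum_contractions_node (R : realType) (V : finType) (l r : ctree V)
    (F : {set V} * {set V} -> R) :
  \sum_(p <- contractions (CNode l r)) F p =
  \sum_(p <- contractions l) F p + (\sum_(p <- contractions r) F p +
    F (vset l, vset r)).
Proof. by rewrite /= !big_cat big_seq1. Qed.

Lemma tree_cost_node (R : realType) (V E : finType) (G : network V E) l r :
  tree_cost R G (CNode l r) =
  tree_cost R G l + (tree_cost R G r + expR (cost R G [set: E] (vset l) (vset r))).
Proof. exact: sum_contractions_node. Qed.

Lemma sum_vset_node (R : realType) (V : finType) (l r : ctree V) (F : V -> R) :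
  [disjoint vset l & vset r] ->
  \sum_(v in vset (CNode l r)) F v =
  \sum_(v in vset l) F v + \sum_(v in vset r) F v.
Proof.
move=> dlr; rewrite -(bigU _ _ _ dlr); apply: eq_bigl => v.
by rewrite !inE.
Qed.

Lemma count_le1 (T : eqType) (P : pred T) (s : seq T) : uniq s ->
  (forall x y, P x -> P y -> x = y) -> (count P s <= 1)%N.
Proof.
move=> + P1; elim: s => //= a s IH /andP[as_ us]; case Pa: (P a); last exact: IH.
rewrite add1n ltnS leqn0 -[_ == _]negbK -lt0n -has_count.
by apply/hasPn => y ys; apply/negP => /(P1 _ _ Pa) ay; rewrite ay ys in as_.
Qed.

Lemma count_predU_le2 (T : eqType) (P Q : pred T) (s : seq T) : uniq s ->
  (forall x y, P x -> P y -> x = y) -> (forall x y, Q x -> Q y -> x = y) ->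
  (count (predU P Q) s <= 2)%N.
Proof.
move=> us P1 Q1; apply: (@leq_trans (count P s + count Q s)).
  by rewrite -count_predUI leq_addr.
by apply: (@leq_add _ _ 1 1); exact: count_le1.
Qed.

(** Double counting of the pairs related by [M]: summed along [j], they carry at
    least the total of [f]; summed along [i], at most [k] times that of [g]. *)
Lemma charging (R : realType) (I J : eqType) (s : seq I) (l : seq J)
    (M : I -> J -> bool) (f : I -> R) (g : J -> R) (k : nat) :
  (forall j, 0 <= g j) ->
  (forall i, i \in s -> exists2 j, j \in l & M i j) ->
  (forall i j, i \in s -> j \in l -> M i j -> f i <= g j) ->
  (forall j, (count (M^~ j) s <= k)%N) ->
  \sum_(i <- s) f i <= k%:R * \sum_(j <- l) g j.
Proof.
move=> g0 exM fg Mk.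
apply: (@le_trans _ _ (\sum_(i <- s) \sum_(j <- l | M i j) g j)).
  rewrite big_seq [leRHS]big_seq; apply: ler_sum => i si.
  have [j lj Mij] := exM i si; apply: le_trans (fg i j si lj Mij) _.
  rewrite (big_rem j)//= Mij lerDl; exact: sumr_ge0.
under eq_bigr do rewrite big_mkcond.
rewrite exchange_big mulr_sumr /=; apply: ler_sum => j _.
rewrite -big_mkcond /= big_const_seq iter_addr addr0 mulr_natl.
exact: ler_wpMn2l.
Qed.

Lemma min_of_naturals (R : realType) (S : R -> Prop) :
  (exists c, S c) -> (forall c, S c -> exists n : nat, c = n%:R) ->
  exists c, is_minimum S c.
Proof.
move=> [c0 Sc0] Snat.
have exn : exists n : nat, `[< S n%:R >].
  by have [n c0n] := Snat _ Sc0; exists n; apply/asboolP; rewrite -c0n.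
case: (ex_minnP exn) => n /asboolP Sn nmin; exists n%:R; split=> // x Sx.
have [k xk] := Snat x Sx; rewrite xk ler_nat; apply: nmin.
by apply/asboolP; rewrite -xk.
Qed.

(** With disjoint children each contraction cost is a product of dimension
    sizes; integrality is what makes an optimum over an infinite family of
    embeddings attained. *)
Lemma tree_cost_nat (R : realType) (V E : finType) (G : network V E) (t : ctree V) :
  (forall e, 0 < dim_size G e)%N -> disjoint_children t ->
  exists n : nat, tree_cost R G t = n%:R.
Proof.
move=> G0 dt; rewrite /tree_cost.
exists (\sum_(p <- contractions t)
  \prod_(e | (e \in [set: E]) && (sticks_out G e p.1 || sticks_out G e p.2))
    dim_size G e)%N.
rewrite natr_sum big_seq [RHS]big_seq; apply: eq_bigr => -[A B] AB.
by rewrite costE ?dt//= expR_sum_weight.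
Qed.

(** * Lower bound for every embedding of the class *)

Section Combined.
Context (R : realType) (VD ED VE EX : finType) (GD : network VD ED).
Context (Ebar : {set ED}) (GE : network VE ({e : ED | e \in Ebar} + EX)%type).
Local Notation G := (combine GD GE).
Local Notation L := (L_edges Ebar EX).
Implicit Types A B : {set VD + VE}.

Definition dpart A : {set VD} := [set v | inl v \in A].

Lemma dpartU A B : dpart (A :|: B) = dpart A :|: dpart B.
Proof. by apply/setP => v; rewrite !inE. Qed.

Lemma dpart_inl v : dpart [set inl v] = [set v].
Proof. by apply/setP => u; rewrite !inE (inj_eq inl_inj). Qed.

Lemma dpart_inr z : dpart [set inr z] = set0.
Proof. by apply/setP => u; rewrite !inE. Qed.

Lemma dpart_disjoint A B : [disjoint A & B] -> [disjoint dpart A & dpart B].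
Proof.
rewrite -!setI_eq0 => /eqP AB; apply/eqP/setP => v.
by have /setP/(_ (inl v)) := AB; rewrite !inE.
Qed.

Lemma mem_inc_data e v : (inl v \in inc G (inl e)) = (v \in inc GD e).
Proof.
rewrite inE mem_imset; last by move=> ? ? [].
by case: (v \in _) => //=; apply/imsetP => -[].
Qed.

Lemma mem_inc_sketched e (eE : e \in Ebar) z :
  (inr z \in inc G (inl e)) = (z \in inc GE (inl (exist _ e eE))).
Proof.
rewrite inE /= (insubT (fun e => e \in Ebar) eE) /=.
by rewrite (mem_imset _ _ inr_inj) orb_idl// => /imsetP[].
Qed.

Lemma mem_inc_unsketched e z : e \notin Ebar -> (inr z \in inc G (inl e)) = false.
Proof.
move=> eE; rewrite inE /= insubN//.
by apply/norP; split; apply/imsetP => -[x]//; rewrite inE.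
Qed.

Lemma mem_inc_embedding e z : (inr z \in inc G (inr e)) = (z \in inc GE (inr e)).
Proof. by rewrite /= (mem_imset _ _ inr_inj). Qed.

Lemma mem_inc_embeddingD e v : (inl v \in inc G (inr e)) = false.
Proof. by apply/imsetP => -[]. Qed.

Lemma sticks_out_data e A : e \notin Ebar ->
  sticks_out G (inl e) A = sticks_out GD e (dpart A).
Proof.
move=> eE.
have adjD B : adj G (inl e) B = adj GD e (dpart B).
  apply/adjP/adjP => [[[v|z]]|[v vi]].
  - by rewrite mem_inc_data => vi vB; exists v; rewrite ?inE.
  - by rewrite mem_inc_unsketched.
  - by rewrite inE => vB; exists (inl v); rewrite ?mem_inc_data.
rewrite /sticks_out !adjD /= eE andbT; congr (_ && (adj GD e _ || _)).
by apply/setP => v; rewrite !inE.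
Qed.

(** Each edge belongs to R or to L, and R sees only the data vertices. *)
Lemma cost_combine A B : [disjoint A & B] ->
  cost R G [set: ED + EX] A B =
  cost R GD (~: Ebar) (dpart A) (dpart B) + cost R G L A B.
Proof.
move=> dAB; rewrite !costE ?dpart_disjoint// addrC.
rewrite (bigID (fun e => e \in L)) /=; congr (_ + _).
  by apply: eq_bigl => e; rewrite inE andbC.
rewrite big_sumType /= [X in _ + X]big_pred0 ?addr0; last first.
  by move=> e; rewrite !inE andbF.
apply: eq_big => [e|e _]; last by [].
rewrite !inE; case: (boolP (e \in Ebar)) => eE; first by rewrite andbF.
by rewrite !sticks_out_data// andbT.
Qed.

Context (isD : is_data GD Ebar) (isE : is_embedding GD GE).

Lemma combine_dim_gt0 e : (0 < dim_size G e)%N.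
Proof.
have [nD _ _] := isD; have [nE _ _] := isE.
by case: e => e /=; [case: (nD e)|case: (nE (inr e))].
Qed.

Lemma L_edge_card e : e \in L -> #|inc G e| = if dangling G e then 1%N else 2%N.
Proof.
have [_ Eb _] := isD; have [_ gE dE] := isE.
rewrite inE; case: e => e /=; last by move=> _; rewrite (card_imset _ inr_inj) gE.
move=> eE; rewrite eE andbF (insubT (fun e => e \in Ebar) eE) /= cardsU.
rewrite (card_imset _ inl_inj) (card_imset _ inr_inj) (Eb e eE).2 gE (dE _).1.
rewrite -[X in (_ - X)%N]/(#|_|) (_ : _ :&: _ = set0) ?cards0//.
by apply/setP => -[x|x]; rewrite !inE; apply/andP => -[/imsetP[]//? _ _ /imsetP[]].
Qed.

Section Linearization.
Context (sigma : VD + VE -> 'I_#|{: VD + VE}|) (lin : is_linearization sigma).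

(** [e] is directed out of [x] in the sketching linearization; [cut_out] sums the
    weights of these edges over L. *)
Definition leaves_by (x : VD + VE) (e : ED + EX) : bool :=
  (x \in inc G e) &&
  (dangling G e || [exists u in inc G e, (sigma x < sigma u)%N]).

(** The edges of L have at most two ends, and the direction given by [sigma]
    leaves only one of them as the tail. *)
Lemma leaves_by_unique x y e : e \in L -> x != y ->
  ~~ (leaves_by x e && leaves_by y e).
Proof.
move=> eL xy; apply/negP => /andP[/andP[xe xo] /andP[ye yo]].
have xyi : [set x; y] \subset inc G e by rewrite subUset !sub1set xe ye.
have c2 : #|[set x; y]| = 2%N by rewrite cards2 xy.
have := subset_leq_card xyi; rewrite c2 (L_edge_card eL).
case: (boolP (dangling G e)) => [//|dang] _.
have incE : inc G e = [set x; y].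
  by apply/esym/eqP; rewrite eqEcard xyi (L_edge_card eL) (negbTE dang) c2.
move: xo yo; rewrite (negbTE dang) incE.
move=> /exists_inP[u ux xu] /exists_inP[w wy yw].
move: ux wy; rewrite !inE.
case/orP => /eqP ux; subst u; first by rewrite ltnn in xu.
case/orP => /eqP wy; subst w; last by rewrite ltnn in yw.
by have := ltn_trans xu yw; rewrite ltnn.
Qed.

(** An edge out of the last vertex of [A] dangles or goes to a higher vertex,
    which is no longer in [A]. *)
Lemma leaves_last_sticks_out A x e : x \in A ->
  (forall y, y \in A -> (sigma y <= sigma x)%N) -> leaves_by x e ->
  sticks_out G e A.
Proof.
move=> xA xmax /andP[xe /orP[dang|/exists_inP[u ue xu]]].
  by rewrite /sticks_out dang orbT andbT; apply/adjP; exists x.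
apply/andP; split; first by apply/adjP; exists x.
apply/orP; left; apply/adjP; exists u; rewrite // inE.
by apply/negP => /xmax; rewrite leqNgt xu.
Qed.

(** The key inequality. The edges out of the last vertex of [A] and those out of
    the last vertex of [B] are disjoint families, by uniqueness of tails, and all
    of them are free in [A] or in [B]. The edges joining [A] to [B], which the
    cost counts only once, therefore do no harm: they have a tail on one side
    only. *)
Lemma cut_out_le_cost A B x y : [disjoint A & B] -> x \in A -> y \in B ->
  (forall u, u \in A -> (sigma u <= sigma x)%N) ->
  (forall u, u \in B -> (sigma u <= sigma y)%N) ->
  cut_out R GD GE sigma x + cut_out R GD GE sigma y <= cost R G L A B.
Proof.
move=> dAB xA yB xmax ymax; rewrite costE// /cut_out.
rewrite big_mkcondr [X in _ + X]big_mkcondr [leRHS]big_mkcondr -big_split /=.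
apply: ler_sum => e eL; rewrite -!/(leaves_by _ e).
have xy : x != y by apply: contraTneq xA => ->; rewrite (disjointFl dAB).
have w0 := weight_ge0 R G e.
have := leaves_by_unique eL xy.
have := @leaves_last_sticks_out A x e xA xmax.
have := @leaves_last_sticks_out B y e yB ymax.
case: (leaves_by x e); case: (leaves_by y e) => //=.
- by move=> _ /(_ isT)->; rewrite addr0.
- by move=> /(_ isT)->; rewrite add0r orbT.
- by rewrite addr0; case: ifP.
Qed.

(** Data vertices precede embedding vertices, so a sketched edge leaves its data
    vertex. *)
Lemma weight_le_cut_out e v : e \in Ebar -> v \in inc GD e ->
  weight R GD e <= cut_out R GD GE sigma (inl v).
Proof.
move=> eE ve; have eL : inl e \in L by rewrite inE.
have [_ gE _] := isE.
have : #|inc GE (inl (exist _ e eE))| != 0%N by rewrite gE; case: ifP.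
rewrite cards_eq0 => /set0Pn[z ze].
rewrite /cut_out (bigD1 (inl e)) ?lerDl; last first.
  rewrite eL mem_inc_data ve; apply/orP; right; apply/exists_inP.
  by exists (inr z); [rewrite mem_inc_sketched|exact: lin.2].
by apply: sumr_ge0 => *; exact: weight_ge0.
Qed.

Context (covD : forall v, exists2 e, e \in Ebar & v \in inc GD e).
Context (dims : forall e, e \in Ebar -> sketch_size R GE < (dim_size GD e)%:R).
Context (effective :
  forall z, ln (sketch_size R GE) <= cut_out R GD GE sigma (inr z)).

Lemma sketch_size_gt0 : 0 < sketch_size R GE.
Proof. exact: expR_gt0. Qed.

(** For a data vertex this comes from its sketched edge, whose size exceeds the
    sketch size. *)
Lemma sketch_size_le_cut_out x : ln (sketch_size R GE) <= cut_out R GD GE sigma x.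
Proof.
case: x => [v|z]; last exact: effective.
have [e eE ve] := covD v; apply: le_trans (weight_le_cut_out eE ve).
have se := dims eE.
rewrite /weight ler_ln ?posrE; [exact: ltW|exact: sketch_size_gt0|].
exact: lt_trans sketch_size_gt0 se.
Qed.

Lemma exists_last A : A != set0 ->
  exists2 x, x \in A & forall y, y \in A -> (sigma y <= sigma x)%N.
Proof.
by case/set0Pn => x0 x0A; case: (arg_maxnP sigma x0A) => x xA xmax; exists x.
Qed.

Lemma cost_ge_internal A B : [disjoint A & B] -> A != set0 -> B != set0 ->
  expR (cost R GD (~: Ebar) (dpart A) (dpart B)) * sketch_size R GE ^+ 2 <=
  expR (cost R G [set: ED + EX] A B).
Proof.
move=> dAB /exists_last[x xA xmax] /exists_last[y yB ymax].
rewrite cost_combine// expRD ler_pM2l ?expR_gt0//.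
apply: le_trans
  (_ : expR (cut_out R GD GE sigma x + cut_out R GD GE sigma y) <= _).
  rewrite expRD expr2.
  by apply: ler_pM; rewrite ?expR_ge0 ?(ltW sketch_size_gt0)//;
    rewrite -[leLHS](lnK sketch_size_gt0) ler_expR sketch_size_le_cut_out.
by rewrite ler_expR; exact: cut_out_le_cost.
Qed.

(** Here the first operand is the single vertex [v], whose sketched edge provides
    the full factor [dim_size GD e] instead of a sketch size. *)
Lemma cost_ge_leaf e v B : e \in Ebar -> v \in inc GD e ->
  [disjoint [set inl v] & B] -> B != set0 ->
  expR (cut R GD (~: Ebar) [set v]) * (dim_size GD e)%:R * sketch_size R GE <=
  expR (cost R G [set: ED + EX] [set inl v] B).
Proof.
move=> eE ve dvB /exists_last[y yB ymax].
rewrite cost_combine// expRD -mulrA; apply: ler_pM; rewrite ?expR_ge0//.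
- by rewrite mulr_ge0// ltW// sketch_size_gt0.
- rewrite ler_expR dpart_inl; apply: le_cut_cost.
  by rewrite -(dpart_inl v) dpart_disjoint.
apply: le_trans
  (_ : expR (cut_out R GD GE sigma (inl v) + cut_out R GD GE sigma y) <= _).
  rewrite expRD; apply: ler_pM; rewrite ?ler0n ?(ltW sketch_size_gt0)//.
    have e0 : 0 < (dim_size GD e)%:R :> R by rewrite ltr0n; have [/(_ e)[]] := isD.
    by rewrite -[leLHS](lnK e0) ler_expR; exact: weight_le_cut_out.
  by rewrite -[leLHS](lnK sketch_size_gt0) ler_expR sketch_size_le_cut_out.
rewrite ler_expR; apply: cut_out_le_cost => //; first by rewrite inE.
by move=> u; rewrite inE => /eqP->.
Qed.

Section TreeLower.
Context (T0 : ctree VD) (TB : ctree (VD + VE)%type).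
Context (disT0 : disjoint_children T0) (treeB : is_contraction_tree TB).
Context (con : constrained T0 TB) (sk : VD -> ED).
Context (skP : forall v, sk v \in Ebar /\ v \in inc GD (sk v)).

(** One contraction can be the first one of two data vertices, hence the factor
    2. The vertex [z0] guarantees that [TB] is not a single leaf. *)
Lemma leaf_costs_le (z0 : VE) :
  \sum_v expR (cut R GD (~: Ebar) [set v]) * (dim_size GD (sk v))%:R *
    sketch_size R GE <= 2 * tree_cost R G TB.
Proof.
have [TBT dTB] := treeB.
apply: (charging (M := fun v q => (q.1 == [set inl v]) || (q.2 == [set inl v]))).
- by move=> j; exact: expR_ge0.
- move=> v _; apply: leaf_contraction; rewrite TBT ?inE//.
  by apply/eqP => /setP/(_ (inr z0)); rewrite !inE.
- move=> v [A B] _ AB /= vAB; have dAB := dTB _ _ AB.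
  have [A0 B0] := contractions_neq0 AB; have [skE vsk] := skP v.
  case/orP: vAB => /eqP E; subst; first exact: cost_ge_leaf.
  by rewrite costC; apply: cost_ge_leaf; rewrite // disjoint_sym.
move=> [A B]; apply: (count_predU_le2 (P := fun v => A == [set inl v])
  (Q := fun v => B == [set inl v])) (index_enum_uniq _) _ _;
  by move=> u v /eqP-> /eqP/set1_inj[].
Qed.

(** The data parts of the two operands determine the contraction of [T0] up to
    the order of the operands, hence the factor 2. *)
Lemma internal_costs_le :
  \sum_(p <- contractions T0)
     expR (cost R GD (~: Ebar) p.1 p.2) * sketch_size R GE ^+ 2 <=
  2 * tree_cost R G TB.
Proof.
have [TBT dTB] := treeB.
apply: (charging (M := fun p q =>
  (p == (dpart q.1, dpart q.2)) || (p == (dpart q.2, dpart q.1)))).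
- by move=> j; exact: expR_ge0.
- move=> [U W] UW; have [A [B [AB <- <-]]] := con UW.
  by case/orP: AB => AB; eexists; try exact: AB; rewrite eqxx ?orbT.
- move=> p [A B] _ AB /= pAB; have dAB := dTB _ _ AB.
  have [A0 B0] := contractions_neq0 AB.
  case/orP: pAB => /eqP-> /=; first exact: cost_ge_internal.
  by rewrite costC; exact: cost_ge_internal.
move=> [A B]; apply: (count_predU_le2 (P := pred1 (dpart A, dpart B))
  (Q := pred1 (dpart B, dpart A))) (contractions_uniq disT0) _ _;
  by move=> p q /eqP-> /eqP->.
Qed.

End TreeLower.
End Linearization.
End Combined.

(** * Upper bound for the tree embedding *)

Section TreeNodes.
Context (V : finType).
Implicit Types t l r : ctree V.

Definition troot t : tnode t :=
  match t return tnode t with CLeaf _ => tt | CNode _ _ => None end.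

Definition tleft l r (x : tnode l) : tnode (CNode l r) :=
  Some (inl x : tnode l + tnode r)%type.

Definition tright l r (x : tnode r) : tnode (CNode l r) :=
  Some (inr x : tnode l + tnode r)%type.

(** Case analysis that keeps [troot], [tleft] and [tright] folded, so that the
    equations for [tparent] below remain applicable. *)
Variant tnode_spec l r : tnode (CNode l r) -> Type :=
| IsRoot : tnode_spec (troot (CNode l r))
| IsLeft x : tnode_spec (tleft r x)
| IsRight x : tnode_spec (tright l x).

Lemma tnodeP l r (x : tnode (CNode l r)) : tnode_spec x.
Proof. by case: x => [[x|x]|]; constructor. Qed.

Lemma tleft_inj l r : injective (@tleft l r).
Proof. by move=> x y []. Qed.

Lemma tright_inj l r : injective (@tright l r).
Proof. by move=> x y []. Qed.

Lemma tparent_left l r (x : tnode l) :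
  tparent (tleft r x) = Some (oapp (@tleft l r) (troot _) (tparent x)).
Proof. by rewrite /=; case: (tparent x). Qed.

Lemma tparent_right l r (x : tnode r) :
  tparent (tright l x) = Some (oapp (@tright l r) (troot _) (tparent x)).
Proof. by rewrite /=; case: (tparent x). Qed.

Lemma tparent_None t (x : tnode t) : tparent x = None -> x = troot t.
Proof. by case: t x => [v []|l r [[x|x]|]]. Qed.

Lemma tleaf_vset t (x : tnode t) v : tleaf x = Some v -> v \in vset t.
Proof.
elim: t x => [u [] [->]|l IHl r IHr x] /=; first by rewrite inE.
by case/tnodeP: x => [|x|x] //=; [move/IHl|move/IHr]; rewrite inE => ->; rewrite ?orbT.
Qed.

Lemma vset_tleaf t v : v \in vset t -> exists x : tnode t, tleaf x = Some v.
Proof.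
elim: t => [u|l IHl r IHr] /=; first by rewrite inE => /eqP->; exists tt.
case/setUP => [/IHl|/IHr] [x xv]; first by exists (tleft r x).
by exists (tright l x).
Qed.

Lemma tleaf_inj t (x y : tnode t) v : disjoint_children t ->
  tleaf x = Some v -> tleaf y = Some v -> x = y.
Proof.
elim: t x y => [u [] []|l IHl r IHr x y /disjoint_childrenP[dl dr dlr]] //.
case/tnodeP: x => [//|x|x]; case/tnodeP: y => [//|y|y] xv yv.
- by congr tleft; exact: IHl.
- have := @tleaf_vset r _ _ yv.
  by rewrite (disjointFr dlr (@tleaf_vset l _ _ xv)).
- have := @tleaf_vset l _ _ yv.
  by rewrite (disjointFl dlr (@tleaf_vset r _ _ xv)).
- by congr tright; exact: IHr.
Qed.

End TreeNodes.

Section SketchTree.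
Context (VD VE : finType).
Implicit Types t l r : ctree VD.

Lemma sketch_tree_node l r (z : tnode (CNode l r) -> VE) :
  sketch_tree z = CNode (CNode (sketch_tree (z \o @tleft _ l r))
                               (sketch_tree (z \o @tright _ l r)))
                        (CLeaf (inr (z (troot _)))).
Proof. by []. Qed.

Lemma sketch_tree_data t (z : tnode t -> VE) v :
  (inl v \in vset (sketch_tree z)) = (v \in vset t).
Proof.
elim: t z => [u|l IHl r IHr] z.
  by rewrite !inE orbF (inj_eq inl_inj).
by rewrite sketch_tree_node !in_setU IHl IHr inE orbF.
Qed.

Lemma sketch_treeP t (z : tnode t -> VE) w :
  reflect (exists x, w = z x) (inr w \in vset (sketch_tree z)).
Proof.
elim: t z w => [u|l IHl r IHr] z w.
  rewrite !inE (inj_eq inr_inj); apply: (iffP eqP) => [->|[[] ->]//].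
  by exists tt.
rewrite sketch_tree_node !in_setU in_set1 (inj_eq inr_inj) -orbA.
apply: (iffP or3P) => [[/IHl[x ->]|/IHr[x ->]|/eqP->]|[x ->]].
- by exists (tleft r x).
- by exists (tright l x).
- by exists (troot (CNode l r)).
case/tnodeP: x => [|x|x]; first exact: Or33.
  by apply: Or31; apply/IHl; exists x.
by apply: Or32; apply/IHr; exists x.
Qed.

End SketchTree.

Lemma dpart_sketch_tree (VD VE : finType) (t : ctree VD) (z : tnode t -> VE) :
  dpart (vset (sketch_tree z)) = vset t.
Proof. by apply/setP => v; rewrite inE sketch_tree_data. Qed.

Section SubtreeMap.
Context (VD : finType) (T0 : ctree VD).

(** [z] places [t] in [T0] as the full subtree below one of its nodes. The last
    clause says that the image is closed under taking children: the only tree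
    edge that can leave it is the one above the image of the root. *)
Definition subtree_map (t : ctree VD) (z : tnode t -> tnode T0) : Prop :=
  [/\ injective z, forall x, tleaf (z x) = tleaf x,
      forall x y, tparent x = Some y -> tparent (z x) = Some (z y)
    & forall w x, tparent w = Some (z x) ->
        exists2 y, w = z y & tparent y = Some x].

Lemma subtree_map_id : subtree_map (fun x : tnode T0 => x).
Proof. by split=> // w x ?; exists w. Qed.

Lemma subtree_map_left l r (z : tnode (CNode l r) -> tnode T0) :
  subtree_map z -> subtree_map (z \o @tleft _ l r).
Proof.
move=> [zI zl zp zc]; split=> [||x y xy|w x /zc[y ->]].
- exact: inj_comp zI (@tleft_inj _ l r).
- by move=> x; exact: zl.
- by apply: (zp (tleft r x) (tleft r y)); rewrite tparent_left xy.
case/tnodeP: y => [//|y|y].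
  rewrite tparent_left; case yp: (tparent y) => [u|//] [E].
  by exists y; rewrite // yp E.
by rewrite tparent_right; case: (tparent y).
Qed.

Lemma subtree_map_right l r (z : tnode (CNode l r) -> tnode T0) :
  subtree_map z -> subtree_map (z \o @tright _ l r).
Proof.
move=> [zI zl zp zc]; split=> [||x y xy|w x /zc[y ->]].
- exact: inj_comp zI (@tright_inj _ l r).
- by move=> x; exact: zl.
- by apply: (zp (tright l x) (tright l y)); rewrite tparent_right xy.
case/tnodeP: y => [//|y|y].
  by rewrite tparent_left; case: (tparent y).
rewrite tparent_right; case yp: (tparent y) => [u|//] [E].
by exists y; rewrite // yp E.
Qed.

Section Disjoint.
Context (l r : ctree VD) (z : tnode (CNode l r) -> tnode T0).
Context (dis : disjoint_children (CNode l r)) (zI : injective z).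
Local Notation A := (vset (sketch_tree (z \o @tleft _ l r))).
Local Notation B := (vset (sketch_tree (z \o @tright _ l r))).

Lemma sketch_children_disjoint : [disjoint A & B].
Proof.
have [_ _ dlr] := disjoint_childrenP dis.
rewrite -setI_eq0; apply/eqP/setP => -[v|w]; rewrite !inE.
  by rewrite !sketch_tree_data; apply/andP => -[vl]; rewrite (disjointFr dlr vl).
by apply/andP => -[/sketch_treeP[x ->] /sketch_treeP[y /zI]].
Qed.

Lemma sketch_root_disjoint : [disjoint A :|: B & [set inr (z (troot _))]].
Proof.
rewrite -setI_eq0; apply/eqP/setP => -[v|w]; rewrite !inE; first by rewrite andbF.
rewrite (inj_eq inr_inj); apply/andP => -[wAB /eqP wz]; move: wAB; rewrite wz.
by case/orP => /sketch_treeP[x /zI].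
Qed.

End Disjoint.
End SubtreeMap.

Section Upper.
Context (R : realType) (VD ED : finType) (GD : network VD ED) (Ebar : {set ED}).
Context (T0 : ctree VD) (m : nat) (m_gt0 : (0 < m)%N).
Context (isD : is_data GD Ebar) (disT0 : disjoint_children T0).
Context (T0T : vset T0 = [set: VD]).
Context (sk : VD -> ED) (skP : forall v, sk v \in Ebar /\ v \in inc GD (sk v)).
Local Notation GE := (tree_embedding GD Ebar T0 m).
Local Notation G := (combine GD GE).
Local Notation L := (L_edges Ebar (tnode T0)).

Lemma sketched_edge e v : e \in Ebar -> v \in inc GD e ->
  e = sk v /\ inc GD e = [set v].
Proof.
have [_ Eb injE] := isD; move=> eE ve.
have inc1 e1 : e1 \in Ebar -> v \in inc GD e1 -> inc GD e1 = [set v].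
  by move=> /Eb[_ /eqP/cards1P[u ->]]; rewrite inE => /eqP->.
have [skE vsk] := skP v; split; last exact: inc1.
by apply: injE => //; rewrite (inc1 _ eE ve) (inc1 _ skE vsk).
Qed.

Lemma mem_inc_matrix e w : e \in Ebar -> inr w \in inc G (inl e) ->
  exists2 v, tleaf w = Some v & v \in inc GD e.
Proof.
move=> eE; rewrite (mem_inc_sketched _ _ eE) inE /=.
by case: (tleaf w) => // v ve; exists v.
Qed.

Lemma mem_inc_treeE w y :
  (inr y \in inc G (inr w)) = (y == w) || (Some y == tparent w).
Proof. by rewrite mem_inc_embedding inE. Qed.

(** A sketched edge joins a data vertex to the matrix at the leaf of that vertex,
    so its ends lie on the same side of any sketched subtree. *)
Lemma mem_sketched_edge (t : ctree VD) (z : tnode t -> tnode T0) e v p :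
  subtree_map z -> e \in Ebar -> v \in inc GD e -> p \in inc G (inl e) ->
  (p \in vset (sketch_tree z)) = (v \in vset t).
Proof.
move=> [_ zl _ _] eE ve; have [_ incv] := sketched_edge eE ve.
case: p => [u|w].
  by rewrite mem_inc_data incv inE sketch_tree_data => /eqP->.
case/(mem_inc_matrix eE) => u wu; rewrite incv inE => /eqP uv; subst u.
apply/sketch_treeP/idP => [[x wx]|/vset_tleaf[x xv]].
  by apply: (@tleaf_vset _ _ x); rewrite -zl -wx.
by exists x; apply: (tleaf_inj disT0 wu); rewrite zl.
Qed.

(** A sketched subtree has a single sketched dimension, the output of the tensor
    at its root. *)
Lemma sticks_out_sketch_tree (t : ctree VD) (z : tnode t -> tnode T0) e :
  subtree_map z -> e \in L -> sticks_out G e (vset (sketch_tree z)) ->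
  e = inr (z (troot t)).
Proof.
move=> zS; have [zI zl zp zc] := zS; rewrite inE; case: e => [e eE|w _].
  rewrite /sticks_out /= eE andbF orbF => /andP[].
  move=> /adjP[p pe pS] /adjP[q qe]; rewrite inE; case/negP.
  have [_ /(_ e eE)[_ /eqP/cards1P[v incv]] _] := isD.
  have ve : v \in inc GD e by rewrite incv inE.
  by rewrite (mem_sketched_edge zS eE ve qe) -(mem_sketched_edge zS eE ve pe).
case/andP => /adjP[[v|y] yw]; first by rewrite mem_inc_embeddingD in yw.
move/sketch_treeP => [x yx]; subst y.
have {yw} [u wu] : exists u, w = z u.
  move: yw; rewrite mem_inc_treeE => /orP[/eqP<-|/eqP/esym/zc[u -> _]].
    by exists x.
  by exists u.
subst w; case up: (tparent u) => [y|]; last by rewrite (tparent_None up).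
have zup := zp _ _ up; rewrite /= zup /= orbF.
case/adjP => -[v|q]; first by rewrite mem_inc_embeddingD.
rewrite mem_inc_treeE zup inE => quy /negP[]; apply/sketch_treeP.
by case/orP: quy => /eqP; [move->; exists u|case=> ->; exists y].
Qed.

Lemma expR_ln_size : expR (ln m%:R) = m%:R :> R.
Proof. by rewrite lnK// posrE ltr0n. Qed.

(** Of the edges of L, only the sketched edge of [v] and the output of the matrix
    are free in one of the two operands. *)
Lemma matrix_cost_le v (z : tnode (CLeaf v) -> tnode T0) : subtree_map z ->
  expR (cost R G [set: _] [set inl v] [set inr (z tt)]) <=
  expR (cut R GD (~: Ebar) [set v]) * (dim_size GD (sk v))%:R * m%:R.
Proof.
move=> [_ zl _ zc].
have dvz : [disjoint [set inl v] & [set inr (z tt) : VD + tnode T0]].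
  by rewrite disjoints1 inE.
rewrite cost_combine// dpart_inl dpart_inr cost_set0 expRD -mulrA.
rewrite ler_pM2l ?expR_gt0// costE//.
have [skE _] := skP v.
have sk0 : (0 < dim_size GD (sk v))%N by have [/(_ (sk v))[]] := isD.
have -> : (dim_size GD (sk v))%:R * m%:R =
  expR (\sum_(e <- [:: inl (sk v); inr (z tt)]) weight R G e).
  rewrite big_cons big_seq1 expRD [weight R G (inr _)]/weight expR_ln_size.
  by rewrite /weight lnK// posrE ltr0n.
rewrite ler_expR; apply: sum_weight_sub => e /andP[]; rewrite !inE.
case: e => [e eE|w _] /orP[] /andP[/adjP[p pe]]; rewrite inE => /eqP pE _;
  move: pe; rewrite pE.
- by rewrite mem_inc_data => /(sketched_edge eE)[-> _]; rewrite eqxx.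
- case/(mem_inc_matrix eE) => u; rewrite zl => -[<-].
  by case/(sketched_edge eE) => -> _; rewrite eqxx.
- by rewrite mem_inc_embeddingD.
- rewrite mem_inc_treeE => /orP[/eqP->|/eqP/esym/zc[] //].
  by rewrite eqxx orbT.
Qed.

Section Node.
Context (l r : ctree VD) (z : tnode (CNode l r) -> tnode T0).
Context (dis : disjoint_children (CNode l r)) (zS : subtree_map z).
Local Notation A := (vset (sketch_tree (z \o @tleft _ l r))).
Local Notation B := (vset (sketch_tree (z \o @tright _ l r))).

(** The two sketched subtrees bring one sketched dimension each. *)
Lemma children_cost_le : expR (cost R G [set: _] A B) <=
  expR (cost R GD (~: Ebar) (vset l) (vset r)) * m%:R ^+ 2.
Proof.
have [zI _ _ _] := zS; have dAB := sketch_children_disjoint dis zI.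
have zl := subtree_map_left zS; have zr := subtree_map_right zS.
rewrite cost_combine// !dpart_sketch_tree expRD ler_pM2l ?expR_gt0// costE//.
rewrite expr2 -expR_ln_size -expRD ler_expR.
apply: le_trans (sum_weight_sub R G (s := [:: inr (z (tleft r (troot l)));
  inr (z (tright l (troot r)))]) _) _; last by rewrite big_cons big_seq1.
move=> e /andP[eL /orP[] eS]; rewrite !inE.
  by rewrite (sticks_out_sketch_tree zl eL eS) eqxx.
by rewrite (sticks_out_sketch_tree zr eL eS) eqxx orbT.
Qed.

(** The three dimensions of the root tensor are free: two sketched dimensions
    coming from the children and its own output. *)
Lemma tensor_cost_le :
  expR (cost R G [set: _] (A :|: B) [set inr (z (troot _))]) <=
  expR (cut R GD (~: Ebar) (vset l :|: vset r)) * m%:R ^+ 3.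
Proof.
have [zI _ _ _] := zS; have dAB := @sketch_root_disjoint _ _ l r _ zI.
have zl := subtree_map_left zS; have zr := subtree_map_right zS.
rewrite cost_combine// dpartU dpart_inr !dpart_sketch_tree cost_set0 expRD.
rewrite ler_pM2l ?expR_gt0// costE//.
rewrite !exprS expr0 mulr1 -expR_ln_size -!expRD ler_expR.
apply: le_trans (sum_weight_sub R G (s := [:: inr (z (tleft r (troot l)));
  inr (z (tright l (troot r))); inr (z (troot _))]) _) _; last first.
  by rewrite !big_cons big_nil addr0.
move=> e /andP[eL /orP[/sticks_outU/orP[] eS|]]; rewrite !inE.
- by rewrite (sticks_out_sketch_tree zl eL eS) eqxx.
- by rewrite (sticks_out_sketch_tree zr eL eS) eqxx orbT.
case/andP => /adjP[p pe]; rewrite inE => /eqP pE _; subst p.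
have [_ zlf _ zc] := zS.
move: eL pe; rewrite inE; case: e => [e eE|w _].
  by case/(mem_inc_matrix eE) => u; rewrite zlf.
rewrite mem_inc_treeE => /orP[/eqP->|]; first by rewrite eqxx !orbT.
move=> /eqP/esym/zc[y ->]; case/tnodeP: y => [//|y|y].
  rewrite tparent_left; case yp: (tparent y) => //= _.
  by rewrite (tparent_None yp) eqxx.
rewrite tparent_right; case yp: (tparent y) => //= _.
by rewrite (tparent_None yp) eqxx orbT.
Qed.

End Node.

(** [size_b] is the ratio between the costs, within R, of contracting [U] with
    [W] and of holding the result. This makes [b >= m] exactly the condition
    under which [children_cost_le] dominates [tensor_cost_le]. *)
Lemma size_bE U W : size_b R GD Ebar U W =
  expR (cost R GD (~: Ebar) U W) / expR (cut R GD (~: Ebar) (U :|: W)).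
Proof.
rewrite /size_b /size_d /size_a /size_c /cost -/(cutR R GD Ebar U).
rewrite -/(cutR R GD Ebar W) -/(cutR2 R GD Ebar U W) -/(cutR R GD Ebar (U :|: W)).
by rewrite -expRD -!expRB; congr (expR _); lra.
Qed.

(** At each node the second contraction, of size [a c d m ^ 3], costs at most the
    first one, of size [a b c d m ^ 2], because [m <= b]. *)
Lemma sketch_tree_cost_le (t : ctree VD) (z : tnode t -> tnode T0) :
  disjoint_children t -> subtree_map z ->
  (forall U W, (U, W) \in contractions t -> m%:R <= size_b R GD Ebar U W) ->
  tree_cost R G (sketch_tree z) <=
  \sum_(v in vset t)
    expR (cut R GD (~: Ebar) [set v]) * (dim_size GD (sk v))%:R * m%:R +
  2 * \sum_(p <- contractions t)
    expR (cost R GD (~: Ebar) p.1 p.2) * m%:R ^+ 2.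
Proof.
elim: t z => [v|l IHl r IHr] z dis zS mb.
  rewrite tree_cost_node /= {1 2}/tree_cost /= !big_nil !add0r mulr0 addr0.
  by rewrite big_set1; exact: matrix_cost_le.
have [dl dr dlr] := disjoint_childrenP dis.
have zl := subtree_map_left zS; have zr := subtree_map_right zS.
rewrite sketch_tree_node 2!tree_cost_node.
rewrite [tree_cost R G (CLeaf _)]/tree_cost big_nil add0r.
have /(IHl _ dl zl) Hl : forall U W, (U, W) \in contractions l ->
    m%:R <= size_b R GD Ebar U W.
  by move=> U W UW; apply: mb; rewrite mem_contractions_node UW.
have /(IHr _ dr zr) Hr : forall U W, (U, W) \in contractions r ->
    m%:R <= size_b R GD Ebar U W.
  by move=> U W UW; apply: mb; rewrite mem_contractions_node UW orbT.
rewrite sum_contractions_node (sum_vset_node _ dlr) /=.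
have Hc := children_cost_le dis zS; have Ht := tensor_cost_le zS.
have Hb : expR (cut R GD (~: Ebar) (vset l :|: vset r)) * m%:R ^+ 3 <=
    expR (cost R GD (~: Ebar) (vset l) (vset r)) * m%:R ^+ 2.
  have := mb (vset l) (vset r); rewrite mem_contractions_node eqxx !orbT size_bE.
  move=> /(_ isT); rewrite ler_pdivlMr ?expR_gt0// => mle.
  by rewrite exprS mulrA ler_wpM2r ?exprn_ge0// mulrC.
move: Hl Hr Hc (le_trans Ht Hb); rewrite /=.
set cl := tree_cost _ _ _; set cr := tree_cost _ _ _.
lra.
Qed.

Lemma tree_embedding_cost_le :
  (forall U W, (U, W) \in contractions T0 -> m%:R <= size_b R GD Ebar U W) ->
  tree_embedding_cost R GD Ebar T0 m <=
  \sum_v expR (cut R GD (~: Ebar) [set v]) * (dim_size GD (sk v))%:R * m%:R +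
  2 * \sum_(p <- contractions T0)
    expR (cost R GD (~: Ebar) p.1 p.2) * m%:R ^+ 2.
Proof.
move=> mb; apply: le_trans (sketch_tree_cost_le disT0 (subtree_map_id T0) mb) _.
by rewrite lerD2r T0T; under eq_bigl do rewrite inE.
Qed.

End Upper.

(** * An admissible embedding, and the optimum *)

Section Star.
Context (R : realType) (VD ED : finType) (GD : network VD ED) (Ebar : {set ED}).
Context (c : VD) (m : nat) (m_gt0 : (0 < m)%N) (isD : is_data GD Ebar).

(** A matrix for each data vertex, all of them joined to the matrix of [c], which
    carries the output. It has as many vertices as there are sketched edges, so
    the sketch size [m] of the tree embedding is admissible for it with the very
    same constants; the tree embedding, with nearly twice as many vertices, need
    not satisfy the upper one. *)
Definition star_embedding : network VD ({e : ED | e \in Ebar} + VD)%type :=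
  Network
    (fun e : {e : ED | e \in Ebar} + VD => match e with
     | inl e0 => inc GD (val e0)
     | inr v => [set v; c]
     end)
    (fun e : {e : ED | e \in Ebar} + VD => match e with
     | inl _ => true
     | inr v => v == c
     end)
    (fun e : {e : ED | e \in Ebar} + VD => match e with
     | inl e0 => dim_size GD (val e0)
     | inr _ => m
     end).

Lemma star_is_embedding : is_embedding GD star_embedding.
Proof.
have [nD Eb _] := isD; split=> [[e|v]|[e|v]|//] /=.
- by have [? ? _] := nD (val e).
- split=> //; first by apply/set0Pn; exists v; rewrite !inE eqxx.
  by rewrite cards2 => ->.
- by have [] := Eb _ (valP e).
- by rewrite cards2; case: eqP.
Qed.

Lemma star_output_edges : output_edges star_embedding = [set c].
Proof. by apply/setP => v; rewrite !inE. Qed.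

Lemma star_sketch_size : sketch_size R star_embedding = m%:R.
Proof.
by rewrite /sketch_size star_output_edges big_set1 /weight lnK// posrE ltr0n.
Qed.

Context (c_last : forall v : VD, (enum_rank v <= enum_rank c)%N).

(** Number the data as in the enumeration and the matrices after them in the same
    order. Each matrix then points to that of [c], the last one. *)
Lemma star_linearization : exists2 sigma : VD + VD -> 'I_#|{: VD + VD}|,
  is_linearization sigma &
  forall v, ln m%:R <= cut_out R GD star_embedding sigma (inr v).
Proof.
have cardE : (#|VD| + #|VD| = #|{: VD + VD}|)%N by rewrite card_sum.
pose sigma (x : VD + VD) : 'I_#|{: VD + VD}| := cast_ord cardE
  match x with
  | inl v => lshift _ (enum_rank v)
  | inr v => rshift _ (enum_rank v)
  end.
exists sigma.
  split=> [[u|u] [v|v] /cast_ord_inj /eqP|v z] /=.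
  - by rewrite (inj_eq (@lshift_inj _ _)) => /eqP/enum_rank_inj->.
  - by rewrite eq_lrshift.
  - by rewrite eq_rlshift.
  - by rewrite (inj_eq (@rshift_inj _ _)) => /eqP/enum_rank_inj->.
  - exact: leq_trans (ltn_ord _) (leq_addr _ _).
move=> v; rewrite /cut_out (bigD1 (inr v)); last first.
  have [vi ci] : inr v \in inc (combine GD star_embedding) (inr v) /\
      inr c \in inc (combine GD star_embedding) (inr v).
    by rewrite !mem_inc_embedding !inE !eqxx orbT.
  rewrite inE vi -[dangling _ _]/(v == c); case: eqVneq => //= vc.
  apply/exists_inP; exists (inr c) => //.
  rewrite /= ltn_add2l ltn_neqAle c_last andbT.
  by rewrite (inj_eq val_inj) (inj_eq enum_rank_inj).
by rewrite lerDl; apply: sumr_ge0 => e _; exact: weight_ge0.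
Qed.

End Star.

(** Contracts each data vertex with its own matrix and then follows the given
    tree, hence is constrained on it. *)
Fixpoint pair_tree (V : Type) (t : ctree V) : ctree (V + V)%type :=
  match t with
  | CLeaf v => CNode (CLeaf (inl v)) (CLeaf (inr v))
  | CNode l r => CNode (pair_tree l) (pair_tree r)
  end.

Section PairTree.
Context (V : finType).
Implicit Types t : ctree V.

Lemma mem_pair_tree t (p : V + V) :
  (p \in vset (pair_tree t)) = (match p with inl v | inr v => v end \in vset t).
Proof.
elim: t => [v|l IHl r IHr] /=; last by rewrite !inE IHl IHr.
by case: p => u; rewrite !inE ?orbF.
Qed.

Lemma pair_tree_disjoint t : disjoint_children t -> disjoint_children (pair_tree t).
Proof.
elim: t => [v _ A B|l IHl r IHr /disjoint_childrenP[dl dr dlr] A B].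
  by rewrite mem_contractions_node => /or3P[//|//|/eqP[-> ->]]; rewrite disjoints1 inE.
rewrite (mem_contractions_node (pair_tree l) (pair_tree r)).
case/or3P => [/(IHl dl)//|/(IHr dr)//|/eqP[-> ->]].
rewrite -setI_eq0; apply/eqP/setP => p.
rewrite in_setI !mem_pair_tree in_set0; apply/andP => -[pl].
by rewrite (disjointFr dlr pl).
Qed.

Lemma pair_tree_constrained t : constrained t (pair_tree t).
Proof.
have dpair (s : ctree V) : [set v | inl v \in vset (pair_tree s)] = vset s.
  by apply/setP => v; rewrite in_set mem_pair_tree.
elim: t => [//|l IHl r IHr] A B.
rewrite mem_contractions_node => /or3P[/IHl|/IHr|/eqP[-> ->]].
- case=> [A' [B' [AB' ? ?]]]; exists A', B'; split=> //.
  by case/orP: AB' => AB'; rewrite /= !mem_cat AB' ?orbT.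
- case=> [A' [B' [AB' ? ?]]]; exists A', B'; split=> //.
  by case/orP: AB' => AB'; rewrite /= !mem_cat AB' ?orbT.
- exists (vset (pair_tree l)), (vset (pair_tree r)).
  by rewrite !dpair; split=> //; rewrite mem_contractions_node eqxx !orbT.
Qed.

End PairTree.

Section Optimum.
Context (R : realType) (k1 k2 eps delta : R) (VD ED : finType).
Context (GD : network VD ED) (Ebar : {set ED}) (T0 : ctree VD) (m : nat).
Context (m_gt0 : (0 < m)%N) (isD : is_data GD Ebar).
Context (covD : forall v : VD, exists2 e : ED, e \in Ebar & v \in inc GD e).
Context (treeT0 : is_contraction_tree T0).

(** Both count the singletons of data vertices: every data vertex has a sketched
    edge, and the sketched edges sit at distinct vertices. *)
Lemma card_sketched : #|VD| = #|Ebar|.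
Proof.
have [_ Eb injE] := isD.
rewrite -[RHS](card_in_imset injE) -[LHS]cardsT -(card_imset _ (@set1_inj VD)).
apply: eq_card => U; apply/imsetP/imsetP => [[v _ ->]|[e eE ->]].
  have [e eE ve] := covD v; exists e => //.
  by have [_ /eqP/cards1P[u ue]] := Eb e eE; move: ve; rewrite ue inE => /eqP->.
by have [_ /eqP/cards1P[u ue]] := Eb e eE; exists u.
Qed.

Lemma constrained_costs_nonempty :
  theta_size k1 k2 eps delta #|Ebar| m%:R ->
  (forall e : ED, e \in Ebar -> (m < dim_size GD e)%N) ->
  exists c, constrained_costs k1 k2 eps delta GD Ebar T0 c.
Proof.
move=> theta dims; have [T0T disT0] := treeT0.
have /set0Pn[v0 _] := vset_neq0 T0.
pose c := [arg max_(v > v0) enum_rank v].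
have c_last (v : VD) : (enum_rank v <= enum_rank c)%N.
  by rewrite /c; case: arg_maxnP => // i _ /(_ v isT).
eexists; exists VD, VD, (star_embedding GD Ebar c m), (pair_tree T0).
rewrite /in_gaussian_class star_sketch_size//; split; last reflexivity.
- split; last by have [] := theta.
  split; [exact: star_is_embedding|by rewrite star_output_edges cards1| |].
    by rewrite card_sketched.
  exact: star_linearization.
- by move=> e eE; rewrite ltr_nat dims.
- split; last exact: pair_tree_disjoint.
  by apply/setP => p; rewrite mem_pair_tree T0T !inE.
- exact: pair_tree_constrained.
Qed.

Lemma constrained_costs_nat c :
  constrained_costs k1 k2 eps delta GD Ebar T0 c -> exists n : nat, c = n%:R.
Proof.
case=> [VE [EX [GE [TB [[[isE _ _ _] _] _ [_ disTB] _ ->]]]]].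
exact: tree_cost_nat (combine_dim_gt0 isD isE) disTB.
Qed.

End Optimum.

(** Both sketch sizes are compared with [N log (1/delta) / eps ^ 2], which gives
    [m <= (k2 / k1) * m'] for the sketch size [m'] of any competitor. Leaf costs
    are linear in the sketch size and internal costs quadratic, and each pays a
    factor 2 in the charging and the internal ones another 2 for the pair of
    contractions at a node. *)
Lemma tree_embedding_cost_le_opt (R : realType) (k1 k2 eps delta : R)
    (VD ED : finType) (GD : network VD ED) (Ebar : {set ED}) (T0 : ctree VD)
    (m : nat) (c : R) :
  0 < k1 <= k2 -> (0 < m)%N -> is_data GD Ebar ->
  (forall v : VD, exists2 e : ED, e \in Ebar & v \in inc GD e) ->
  is_contraction_tree T0 ->
  theta_size k1 k2 eps delta #|Ebar| m%:R ->
  (forall U W : {set VD}, (U, W) \in contractions T0 ->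
     m%:R <= size_b R GD Ebar U W) ->
  constrained_costs k1 k2 eps delta GD Ebar T0 c ->
  tree_embedding_cost R GD Ebar T0 m <=
    (2 * (k2 / k1) + 4 * (k2 / k1) ^+ 2) * c.
Proof.
move=> /andP[k1_gt0 k12] m_gt0 isD covD [T0T disT0] [_ m_le] mb.
case=> [VE [EX [GE [TB [[[isE out1 _ [sigma lin eff]] m'_ge] dims treeB con ->]]]]].
set m' := sketch_size R GE in eff m'_ge dims *.
set kappa := k2 / k1.
have kappa_ge0 : 0 <= kappa by rewrite divr_ge0 ?ltW// (lt_le_trans k1_gt0).
have mm' : m%:R <= kappa * m'.
  apply: le_trans m_le _; rewrite /kappa -mulrA.
  rewrite ler_wpM2l ?(ltW (lt_le_trans k1_gt0 k12))//.
  by rewrite ler_pdivlMl.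
have m'_gt0 : 0 < m' := sketch_size_gt0 R GE.
have /boolp.choice[sk skP] : forall v : VD,
    exists e : ED, e \in Ebar /\ v \in inc GD e.
  by move=> v; have [e ? ?] := covD v; exists e.
have [z0 _] : exists z0 : VE, True.
  move/eqP: out1 => /cards1P[e _].
  by have [/(_ (inr e))[_ /set0Pn[z0 _] _] _ _] := isE; exists z0.
have leaves := leaf_costs_le isD isE lin covD dims eff treeB skP z0.
have internal := internal_costs_le isD isE lin covD dims eff disT0 treeB con.
apply: le_trans (tree_embedding_cost_le m_gt0 isD disT0 T0T skP mb) _.
rewrite [leRHS]mulrDl; apply: lerD.
  apply: (@le_trans _ _ (kappa * \sum_v expR (cut R GD (~: Ebar) [set v]) *
      (dim_size GD (sk v))%:R * m')).
    rewrite mulr_sumr; apply: ler_sum => v _.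
    by rewrite mulrCA ler_wpM2l// mulr_ge0 ?expR_ge0.
  by apply: le_trans (ler_wpM2l kappa_ge0 leaves) _; rewrite mulrCA mulrA.
apply: (@le_trans _ _ (2 * (kappa ^+ 2 * \sum_(p <- contractions T0)
    expR (cost R GD (~: Ebar) p.1 p.2) * m' ^+ 2))).
  rewrite ler_wpM2l// mulr_sumr; apply: ler_sum => p _.
  rewrite [leRHS]mulrCA ler_wpM2l ?expR_ge0// -exprMn lerXn2r// nnegrE ?ler0n//.
  by rewrite mulr_ge0// ltW.
have : kappa ^+ 2 * (\sum_(p <- contractions T0)
    expR (cost R GD (~: Ebar) p.1 p.2) * m' ^+ 2) <=
    kappa ^+ 2 * (2 * tree_cost R (combine GD GE) TB).
  by rewrite ler_wpM2l// exprn_ge0.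
lra.
Qed.

Theorem theorem4p3 (R : realType) (k1 k2 : R) (hk : 0 < k1 <= k2) :
  exists2 C : R, 0 < C &
  forall (eps delta : R) (VD ED : finType) (GD : network VD ED)
    (Ebar : {set ED}) (T0 : ctree VD) (m : nat),
    0 < eps -> 0 < delta < 1 ->
    is_data GD Ebar ->
    (forall v : VD, exists2 e : ED, e \in Ebar & v \in inc GD e) ->
    is_contraction_tree T0 ->
    theta_size k1 k2 eps delta #|Ebar| m%:R ->
    (forall e : ED, e \in Ebar -> (m < dim_size GD e)%N) ->
    (forall U W : {set VD}, (U, W) \in contractions T0 ->
       m%:R <= size_b R GD Ebar U W) ->
    exists2 c_opt : R,
      is_minimum (constrained_costs k1 k2 eps delta GD Ebar T0) c_opt &
      tree_embedding_cost R GD Ebar T0 m <= C * c_opt.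
Proof.
have /andP[k1_gt0 k12] := hk; have k2_gt0 := lt_le_trans k1_gt0 k12.
exists (2 * (k2 / k1) + 4 * (k2 / k1) ^+ 2).
  by rewrite addr_gt0 ?mulr_gt0 ?exprn_gt0 ?divr_gt0// invr_gt0.
move=> eps delta VD ED GD Ebar T0 m eps_gt0 /andP[delta_gt0 delta_lt1] isD covD
  treeT0 theta dims mb.
have m_gt0 : (0 < m)%N.
  rewrite -(ltr0n R); apply: lt_le_trans (proj1 theta).
  have /set0Pn[v _] := vset_neq0 T0; have [e eE _] := covD v.
  rewrite !mulr_gt0// ?invr_gt0 ?exprn_gt0//.
    by rewrite ltr0n; apply/card_gt0P; exists e.
  by rewrite ln_gt0// ltr_pdivlMr// mul1r.
have [c_opt c_min] := min_of_naturals
  (constrained_costs_nonempty m_gt0 isD covD treeT0 theta dims)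
  (@constrained_costs_nat R k1 k2 eps delta VD ED GD Ebar T0 isD).
exists c_opt => //.
exact: tree_embedding_cost_le_opt hk m_gt0 isD covD treeT0 theta mb c_min.1.
Qed.
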